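(* Let $A$ be a unital $C^*$-algebra and let $B\subseteq A$ be a $C^*$-subalgebra such that $uBu^*\subseteq B$ for every $u\in U_A$. Then $uBu^*\subseteq B$ for every $u\in U(A)$.
   Context: $U(A)$ is the unitary group of $A$ with the norm topology, and $U_A$ is the connected component of $1$ in $U(A)$. *)

(* Defs.v *)
From HB Require Import structures.
From mathcomp Require Import all_boot all_order all_algebra.
From mathcomp Require Import complex.
From mathcomp Require Import all_classical all_reals all_analysis.

Set Implicit Arguments.
Unset Strict Implicit.
Unset Printing Implicit Defensive.

Import Order.TTheory GRing.Theory Num.Theory.
Import numFieldNormedType.Exports.

Local Open Scope classical_set_scope.
Local Open Scope ring_scope.
Local Open Scope complex_scope.

(* The norm of a normed module over R[i] takes its values in R[i]; they are
   nonnegative, hence real. *)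

(* The multiplication is part of the mixin, and the ring structure is installed
   by an instance afterwards: an HB structure joining a ring with a normed
   module would have to be declared before numDomainType. The ring may be zero,
   so it is a pzRingType and the library's algType does not apply. *)
HB.mixin Record isUnitalBanachAlgebra (R : realType) A
    of CompleteNormedModule R[i] A := {
  bone : A ;
  bmul : A -> A -> A ;
  bmulA : associative bmul ;
  bmul1r : left_id bone bmul ;
  bmulr1 : right_id bone bmul ;
  bmulDl : left_distributive bmul +%R ;
  bmulDr : right_distributive bmul +%R ;
  bscaleAl : forall (k : R[i]) (x y : A), k *: bmul x y = bmul (k *: x) y ;
  bscaleAr : forall (k : R[i]) (x y : A), k *: bmul x y = bmul x (k *: y) ;
  ler_norm_bmul : forall x y : A, `|bmul x y| <= `|x| * `|y|
}.

#[short(type="unitalBanachAlgType")]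
HB.structure Definition UnitalBanachAlgebra (R : realType) :=
  { A of CompleteNormedModule R[i] A & isUnitalBanachAlgebra R A }.

HB.instance Definition _ (R : realType) (A : unitalBanachAlgType R) :=
  GRing.Zmodule_isPzRing.Build A
    (@bmulA R A) (@bmul1r R A) (@bmulr1 R A) (@bmulDl R A) (@bmulDr R A).

HB.mixin Record isCStarAlgebra (R : realType) A of UnitalBanachAlgebra R A := {
  star : A -> A ;
  starD : forall x y : A, star (x + y) = star x + star y ;
  starZ : forall (k : R[i]) (x : A), star (k *: x) = Num.conj k *: star x ;
  starM : forall x y : A, star (bmul x y) = bmul (star y) (star x) ;
  starK : forall x : A, star (star x) = x ;
  cstar_norm : forall x : A, `|bmul (star x) x| = `|x| ^+ 2
}.

#[short(type="unitalCStarAlgType")]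
HB.structure Definition UnitalCStarAlgebra (R : realType) :=
  { A of UnitalBanachAlgebra R A & isCStarAlgebra R A }.

HB.instance Definition _ (R : realType) (A : unitalCStarAlgType R) :=
  GRing.PzRing.copy A (A : unitalBanachAlgType R).

(* B need not contain the unit of A. *)
Record is_cstar_subalgebra (R : realType) (A : unitalCStarAlgType R)
    (B : set A) : Prop := IsCStarSubalgebra {
  csub0 : B 0 ;
  csubD : forall x y, B x -> B y -> B (x + y) ;
  csubZ : forall (k : R[i]) x, B x -> B (k *: x) ;
  csubM : forall x y, B x -> B y -> B (x * y) ;
  csub_star : forall x, B x -> B (star x) ;
  csub_closed : closed B
}.

Definition unitary_group (R : realType) (A : unitalCStarAlgType R) : set A :=
  [set u | star u * u = 1 /\ u * star u = 1].

(* connected_component S x is the component of x in S with the topology induced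
   from the ambient space, here the norm topology of A. *)
Definition unitary_component1 (R : realType) (A : unitalCStarAlgType R) :
  set A := connected_component (@unitary_group R A) 1.

Definition conj_by (R : realType) (A : unitalCStarAlgType R) (u : A)
  (B : set A) : set A := [set u * b * star u | b in B].

(* Main.v *)
Require Import Defs.
From HB Require Import structures.
From mathcomp Require Import all_boot all_order all_algebra.
From mathcomp Require Import complex.
From mathcomp Require Import all_classical all_reals all_analysis.
From mathcomp Require Import ring lra.

Set Implicit Arguments.
Unset Strict Implicit.
Unset Printing Implicit Defensive.

Import Order.TTheory GRing.Theory Num.Theory.
Import numFieldNormedType.Exports.

Local Open Scope classical_set_scope.
Local Open Scope ring_scope.

(** Since [u b u* - b = [u, b] u*], it suffices that a two-sided ideal of [A]
    contained in [B] contains all commutators [[b, a]] with [b] in [B] and [a]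
    in [A]. The ideal used is the largest one, [ideal_core B], which consists of
    the [z] with [A z A] inside [B].

    Invariance under the identity component makes [B] a Lie ideal. For [z]
    skew-adjoint, the Cayley transforms [(1 - t z)(1 + t z)^-1] are unitary and
    connected to [1], and conjugating [b] by them gives elements of [B] whose
    difference quotients converge to a multiple of [[b, z]]
    ([commutator_mem_skew]). Every element of [A] is a complex combination of two
    skew-adjoint ones, so [[b, a]] lies in [B] for all [a].

    A subalgebra that is a Lie ideal has [[B, B]] in its [ideal_core], by the
    Leibniz rule ([commutator_core]). In particular [[b, [b, a]]] is in the ideal
    for all [a]; taking [a^2] for [a] shows that [[b, a]^2] is as well
    ([commutator_sqr_core]). If [a] and [b] are skew-adjoint then so is
    [x = [b, a]], and a closed ideal that contains [x^2] contains [x]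
    ([core_sqrt]). In the quotient by the ideal this says that the image of [B]
    is central, but working with the ideal itself avoids quotient algebras.

    The analytic input is a single fact about a skew-adjoint [z]: [1 + z] has an
    inverse of norm at most [1] ([skew_inverse]). It rests on the Neumann series
    and the C*-identity only, without spectral theory or functional calculus. *)

(** * The real-valued norm *)

(** The norm of a normed module over [R[i]] is a complex number; its real part is
    the same number in the ordered field [R], where linear arithmetic applies. *)
Definition rnorm (R : realType) (A : unitalCStarAlgType R) (x : A) : R :=
  complex.Re `|x|.

Section Norm.
Local Open Scope complex_scope.
Variables (R : realType) (A : unitalCStarAlgType R).
Implicit Types x y z : A.

Lemma rnormE x : `|x| = (rnorm x)%:C.
Proof. by rewrite /rnorm RRe_real // normr_real. Qed.

Lemma rnorm_ge0 x : 0 <= rnorm x.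
Proof. by rewrite -ler0c -rnormE normr_ge0. Qed.

Lemma rnorm0 : rnorm (0 : A) = 0.
Proof. by rewrite /rnorm normr0. Qed.

Lemma rnorm_eq0 x : rnorm x = 0 -> x = 0.
Proof. by move=> h; apply/eqP; rewrite -normr_eq0 rnormE h. Qed.

Lemma rnormN x : rnorm (- x) = rnorm x.
Proof. by rewrite /rnorm normrN. Qed.

Lemma rnormD x y : rnorm (x + y) <= rnorm x + rnorm y.
Proof. by rewrite -lecR rmorphD /= -!rnormE ler_normD. Qed.

Lemma rnormB x y : rnorm (x - y) <= rnorm x + rnorm y.
Proof. by rewrite -(rnormN y) rnormD. Qed.

Lemma rnormM x y : rnorm (x * y) <= rnorm x * rnorm y.
Proof. by rewrite -lecR rmorphM /= -!rnormE ler_norm_bmul. Qed.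

Lemma rnormZ (t : R) x : rnorm (t%:C *: x) = `|t| * rnorm x.
Proof.
apply: complexI; rewrite rmorphM /= -!rnormE normrZ normc_def /=.
by rewrite expr0n addr0 sqrtr_sqr.
Qed.

Lemma rnorm_star_mul x : rnorm (star x * x) = rnorm x ^+ 2.
Proof. by apply: complexI; rewrite rmorphXn /= -!rnormE -cstar_norm. Qed.

Lemma scaleMl (k : R[i]) x y : (k *: x) * y = k *: (x * y).
Proof. by rewrite [RHS]bscaleAl. Qed.

Lemma scaleMr (k : R[i]) x y : x * (k *: y) = k *: (x * y).
Proof. by rewrite [RHS]bscaleAr. Qed.

Lemma star0 : star 0 = 0 :> A.
Proof. by apply: (addrI (star 0)); rewrite -starD !addr0. Qed.

Lemma starN x : star (- x) = - star x.
Proof. by apply: (addrI (star x)); rewrite -starD !subrr star0. Qed.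

Lemma starB x y : star (x - y) = star x - star y.
Proof. by rewrite starD starN. Qed.

Lemma starMr x y : star (x * y) = star y * star x.
Proof. exact: starM. Qed.

Lemma star1 : star 1 = 1 :> A.
Proof. by rewrite -[star 1]mulr1 -{2}(starK 1) -starMr mulr1 starK. Qed.

Lemma starZr (t : R) x : star (t%:C *: x) = t%:C *: star x.
Proof. by rewrite starZ -[Num.conj _]/(t%:C)^*%C conjc_real. Qed.

Lemma rnorm1 : rnorm (1 : A) <= 1.
Proof.
have := rnorm_star_mul 1; rewrite star1 mul1r => /eqP.
have := rnorm_ge0 1; nra.
Qed.

(** From the C*-identity. Only an inequality holds in general, because the
    algebra may be zero. *)
Lemma rnorm_unitary x : star x * x = 1 -> rnorm x <= 1.
Proof.
move=> h; have := rnorm_star_mul x; rewrite h.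
have := rnorm1; have := rnorm_ge0 x; nra.
Qed.

Lemma nbhs_rnormP (P : set A) x :
  nbhs x P <-> exists2 e : R, 0 < e & forall y, rnorm (x - y) < e -> P y.
Proof.
split=> [/nbhs_ballP [e /= e0 h]|[e e0 h]].
  exists (complex.Re e); first by move: e0; rewrite ltcE => /andP[].
  move=> y xy; apply: h; rewrite -ball_normE /= rnormE.
  by rewrite -(RRe_real (gtr0_real e0)) ltcR.
apply/nbhs_ballP; exists e%:C => /=; first by rewrite ltcR.
by move=> y; rewrite -ball_normE /= rnormE ltcR; exact: h.
Qed.

Lemma closed_approx (B : set A) x : closed B ->
  (forall e : R, 0 < e -> exists2 y, B y & rnorm (x - y) < e) -> B x.
Proof.
move=> cB h; apply: cB => P /nbhs_rnormP [e e0 hP].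
by have [y By xy] := h e e0; exists y; split=> //; apply: hP.
Qed.

Lemma rnorm_complete (u : nat -> A) (e : nat -> R) :
  (forall m n, (m <= n)%N -> rnorm (u m - u n) <= e m) ->
  e @ \oo --> (0 : R) ->
  exists l, forall n, rnorm (l - u n) <= e n.
Proof.
move=> hu e0.
have cu : cvg (u @ \oo).
  apply: cauchy_cvg; apply: cauchy_exP => d /= d0.
  have d'0 : 0 < complex.Re d by move: d0; rewrite ltcE => /andP[].
  have /cvgrPdist_lt/(_ _ d'0) [N _ hN] := e0.
  exists (u N); exists N => // n /= Nn; rewrite -ball_normE /= rnormE.
  rewrite -(RRe_real (gtr0_real d0)) ltcR.
  apply: le_lt_trans (hu _ _ Nn) _.
  have := hN N (leqnn N); rewrite sub0r normrN; apply: le_lt_trans.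
  exact: ler_norm.
exists (lim (u @ \oo)) => n; apply/ler_addgt0Pr => d d0.
have hd0 : exists2 d' : R, 0 < d' &
    forall y, rnorm (lim (u @ \oo) - y) < d' -> rnorm (lim (u @ \oo) - y) < d.
  by exists d.
have [N _ hN] := cu _ (proj2
  (nbhs_rnormP [set y | rnorm (lim (u @ \oo) - y) < d] _) hd0).
have := hN (maxn N n) (leq_maxl _ _) => /= h1.
have h2 := hu n (maxn N n) (leq_maxr _ _).
have -> : lim (u @ \oo) - u n =
    (lim (u @ \oo) - u (maxn N n)) - (u n - u (maxn N n)).
  by rewrite opprB addrA subrK.
apply: le_trans (rnormB _ _) _; rewrite addrC lerD //.
exact: ltW.
Qed.

(** The partial sums of the geometric series are Cauchy, and their limit is the
    inverse. The radius one half is all that the doubling argument for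
    skew-adjoint elements consumes. *)
Lemma neumann_inverse x : rnorm x <= 2^-1 ->
  exists r, r * (1 - x) = 1 /\ (1 - x) * r = 1.
Proof.
move=> hx; pose u n := \sum_(i < n) x ^+ i.
pose e n : R := 2 * 2^-1 ^+ n.
have hX n : rnorm (x ^+ n) <= 2^-1 ^+ n.
  elim: n => [|n IH]; first by rewrite !expr0 rnorm1.
  rewrite !exprS; apply: le_trans (rnormM _ _) _.
  by apply: ler_pM; rewrite ?rnorm_ge0.
have uS n : u n.+1 = u n + x ^+ n by rewrite /u big_ord_recr.
have e0 : e @ \oo --> (0 : R).
  rewrite -(mulr0 2); apply: cvgMl_tmp.
  by apply: cvg_expr; rewrite gtr0_norm; lra.
have hu m n : (m <= n)%N -> rnorm (u m - u n) <= e m.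
  (* The sharper bound [e m - e n] telescopes, hence allows induction on [n]. *)
  move=> mn; suff : rnorm (u m - u n) <= e m - e n.
    have en : 0 <= e n by rewrite mulr_ge0 // exprn_ge0 // invr_ge0.
    by move=> h; lra.
  elim: n mn => [|n IH].
    by rewrite leqn0 => /eqP ->; rewrite !subrr rnorm0.
  rewrite leq_eqVlt => /orP[/eqP <-|]; first by rewrite !subrr rnorm0.
  rewrite ltnS => /IH h; rewrite uS opprD addrA.
  apply: le_trans (rnormB _ _) _; move: h (hX n); rewrite /e exprS; lra.
have [l hl] := rnorm_complete hu e0.
have hy y : (forall n, rnorm (y - 1) <= 4 * e n) -> y = 1.
  move=> h; apply/eqP; rewrite -subr_eq0; apply/eqP/rnorm_eq0/eqP.
  rewrite eq_le rnorm_ge0 andbT.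
  have h4 : (fun n => 4 * e n) @ \oo --> (0 : R).
    by rewrite -(mulr0 4); apply: cvgMl_tmp.
  by apply: (cvgr_to_ge h4); exists 0%N => // n _; exact: h.
have n1x : rnorm (1 - x) <= 2.
  by apply: le_trans (rnormB _ _) _; have := rnorm1; lra.
have hexp n : 1 - u n * (1 - x) = x ^+ n.
  elim: n => [|n IH]; first by rewrite /u big_ord0 mul0r subr0.
  rewrite uS mulrDl opprD addrA IH.
  by rewrite mulrBr mulr1 -exprSr opprB addrC subrK.
have hexp' n : 1 - (1 - x) * u n = x ^+ n.
  elim: n => [|n IH]; first by rewrite /u big_ord0 mulr0 subr0.
  rewrite uS mulrDr opprD addrA IH.
  by rewrite mulrBl mul1r -exprS opprB addrC subrK.
exists l; split; apply: hy => n.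
- have -> : l * (1 - x) - 1 = (l - u n) * (1 - x) - x ^+ n.
    by rewrite -(hexp n) mulrBl opprB addrA subrK.
  apply: le_trans (rnormB _ _) _.
  have := rnormM (l - u n) (1 - x); have := hl n; have := hX n.
  have := rnorm_ge0 (l - u n); have := rnorm_ge0 (1 - x); rewrite /e; nra.
- have -> : (1 - x) * l - 1 = (1 - x) * (l - u n) - x ^+ n.
    by rewrite -(hexp' n) mulrBr opprB addrA subrK.
  apply: le_trans (rnormB _ _) _.
  have := rnormM (1 - x) (l - u n); have := hl n; have := hX n.
  have := rnorm_ge0 (l - u n); have := rnorm_ge0 (1 - x); rewrite /e; nra.
Qed.
End Norm.

(** * Resolvents of skew-adjoint elements and the Cayley transform *)

Definition inverse_of (S : pzRingType) (x r : S) := r * x = 1 /\ x * r = 1.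

Lemma inverse_unique (S : pzRingType) (x r q : S) :
  inverse_of x r -> inverse_of x q -> r = q.
Proof. by move=> [rx _] [_ xq]; rewrite -[r]mulr1 -xq mulrA rx mul1r. Qed.

(** Skew-adjoint elements [z = i y] replace self-adjoint [y], so that the
    resolvents [(1 + t z)^-1] involve only real scalars [t], and commutators of
    skew-adjoint elements are skew-adjoint. *)
Definition skew_adjoint (R : realType) (A : unitalCStarAlgType R) (z : A) :=
  star z = - z.

Section Cayley.
Local Open Scope complex_scope.
Variables (R : realType) (A : unitalCStarAlgType R).
Implicit Types (x y z r b : A) (t : R).

Lemma skewZ t z : skew_adjoint z -> skew_adjoint (t%:C *: z).
Proof. by rewrite /skew_adjoint starZr => ->; rewrite scalerN. Qed.

Lemma star_inverse z r : skew_adjoint z -> inverse_of (1 + z) r ->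
  inverse_of (1 - z) (star r).
Proof.
move=> hz [rs sr]; have <- : star (1 + z) = 1 - z by rewrite starD star1 hz.
by rewrite /inverse_of -!starMr rs sr star1.
Qed.

Lemma cayleyE z r : inverse_of (1 + z) r ->
  (r * (1 - z) = r + r - 1) /\ ((1 - z) * r = r + r - 1).
Proof.
move=> [rs sr]; have -> : 1 - z = 1 + 1 - (1 + z) by rewrite opprD addrA addrK.
by rewrite mulrBr mulrBl rs sr mulrDl mulrDr mulr1 mul1r.
Qed.

(** The Cayley transform of [z] is [(1 - z)(1 + z)^-1 = 2 r - 1]; it is unitary
    because [star] exchanges [1 - z] with [1 + z] and all factors commute. *)
Lemma cayley_unitary z r : skew_adjoint z -> inverse_of (1 + z) r ->
  unitary_group (r + r - 1).
Proof.
move=> hz hr; have hr' := star_inverse hz hr.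
have [rz zr] := cayleyE hr.
have su : star (r + r - 1) = star r + star r - 1 by rewrite starB starD star1.
have hr'' : inverse_of (1 + (- z)) (star r) by [].
have [] := cayleyE hr''; rewrite opprK => rz' zr'.
rewrite /unitary_group /= su; split.
- by rewrite -rz' -rz mulrA -(mulrA _ _ r) (proj2 hr) mulr1 (proj1 hr').
- by rewrite -rz' -rz mulrA -(mulrA _ _ (star r)) (proj2 hr') mulr1 (proj1 hr).
Qed.

Lemma add_halves z : 2^-1%:C *: z + 2^-1%:C *: z = z.
Proof.
rewrite -scalerDl -rmorphD /= (_ : 2^-1 + 2^-1 = 1 :> R) ?scale1r //.
by field.
Qed.

(** [2 r] is [1] plus a unitary element. *)
Lemma skew_inverse_norm z r : skew_adjoint z -> inverse_of (1 + z) r ->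
  rnorm r <= 1.
Proof.
move=> hz hr; have hu : rnorm (r + r - 1) <= 1.
  by apply: rnorm_unitary; have [] := cayley_unitary hz hr.
have -> : r = 2^-1%:C *: ((r + r - 1) + 1).
  by rewrite subrK scalerDr add_halves.
rewrite rnormZ ger0_norm ?invr_ge0 //.
have := rnormD (r + r - 1) 1; have := rnorm1 A; lra.
Qed.

(** The Neumann series covers small [z]. If [s = 1 + z/2] has the inverse [q], then
    [1 + z = 2 s - 1 = 2 s (1 - q/2)], and the norm bound [rnorm q <= 1] makes
    [1 - q/2] invertible; so invertibility propagates by doubling [z]. *)
Lemma skew_invertible z : skew_adjoint z -> exists r, inverse_of (1 + z) r.
Proof.
move=> hz.
have [n hn] : exists n, rnorm z <= 2^-1 * 2 ^+ n.
  exists (Num.bound (2 * rnorm z)).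
  by have /ltW := upper_nthrootP (leqnn (Num.bound (2 * rnorm z))); lra.
elim: n z hz hn => [|n IH] z hz hn.
  have [|r hr] := @neumann_inverse _ _ (- z); first by rewrite rnormN; lra.
  by exists r; rewrite opprK in hr.
have [||q hq] := IH (2^-1%:C *: z); first exact: skewZ.
  by rewrite rnormZ ger0_norm ?invr_ge0 //; move: hn; rewrite exprS; lra.
set s := 1 + _ in hq; pose h := 2^-1%:C *: q.
have hh : h + h = q by exact: add_halves.
have q1 : rnorm q <= 1 by apply: skew_inverse_norm hq; apply: skewZ.
have [|p hp] := @neumann_inverse _ _ h.
  by rewrite rnormZ ger0_norm ?invr_ge0 //; lra.
have zE : 1 + z = s + s - 1.
  by rewrite /s addrACA add_halves addrAC addrK.
exists (p * h); split.
- rewrite zE -mulrA mulrBr mulr1.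
  have -> : h * (s + s) - h = 1 - h by rewrite mulrDr -mulrDl hh (proj1 hq).
  exact: (proj1 hp).
- have hpc : p * h = h * p.
    have [h1 h2] := hp; apply: oppr_inj; apply: (addrI p).
    by rewrite -{1}[p]mulr1 -{3}[p]mul1r -mulrBr -mulrBl h1 h2.
  rewrite hpc mulrA zE mulrBl mul1r.
  have -> : (s + s) * h - h = 1 - h by rewrite mulrDl -mulrDr hh (proj2 hq).
  exact: (proj2 hp).
Qed.

Lemma skew_inverse z : skew_adjoint z ->
  exists r, inverse_of (1 + z) r /\ rnorm r <= 1.
Proof.
by move=> hz; have [r hr] := skew_invertible hz; exists r; split=> //;
  apply: skew_inverse_norm hr.
Qed.

(** The Cayley transforms of [t z], [t] real, form a continuous path of unitaries
    through [1] (at [t = 0]) and the given one (at [t = 1]); continuity comes from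
    the resolvent identity [f t - f s = (s - t) f(t) z f(s)]. *)
Lemma unitary_component1_cayley z r : skew_adjoint z -> inverse_of (1 + z) r ->
  unitary_component1 (r + r - 1).
Proof.
move=> hz hr.
have hzt t : skew_adjoint (t%:C *: z) by exact: skewZ.
have [f hf] := choice (fun t => skew_inverse (hzt t)).
have f0 : f 0 = 1.
  apply: inverse_unique (proj1 (hf 0)) _; rewrite scale0r addr0.
  by split; rewrite mulr1.
have f1 : f 1 = r by apply: inverse_unique (proj1 (hf 1)) _; rewrite scale1r.
have fB t s : rnorm (f t - f s) <= `|t - s| * rnorm z.
  have -> : f t - f s = (s - t)%:C *: (f t * z * f s).
    rewrite -scaleMl -scaleMr rmorphB /= scalerBl.
    have -> : s%:C *: z - t%:C *: z = (1 + s%:C *: z) - (1 + t%:C *: z).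
      by rewrite opprD addrACA subrr add0r.
    rewrite mulrBr mulrBl -mulrA.
    by have [[-> _] _] := hf t; have [[_ ->] _] := hf s; rewrite mulr1 mul1r.
  rewrite rnormZ distrC ler_wpM2l //.
  apply: le_trans (rnormM _ _) _; have := rnormM (f t) z.
  have [_ ht] := hf t; have [_ hs] := hf s.
  have := rnorm_ge0 (f t); have := rnorm_ge0 (f s); have := rnorm_ge0 z.
  have := rnorm_ge0 (f t * z); nra.
pose g t := f t + f t - 1.
have hB : (range g) (r + r - 1) by exists 1 => //; rewrite /g f1.
apply: (connected_component_max _ _ _ hB).
- by exists 0 => //; rewrite /g f0 addrK.
- by move=> _ [t _ <-]; apply: cayley_unitary (proj1 (hf t)).
- apply: connected_continuous_connected.
    by apply/connected_intervalP => ? ? ? ? ? ?.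
  apply: continuous_subspaceT => t P /nbhs_rnormP [e e0 he].
  apply/nbhs_ballP; exists (e / (2 * (rnorm z + 1))).
    by rewrite /= divr_gt0 // mulr_gt0 //; have := rnorm_ge0 z; lra.
  move=> s /=; rewrite /ball /= => hs; apply: he.
  have -> : g t - g s = (f t - f s) + (f t - f s).
    by rewrite /g opprB addrA subrK opprD addrACA.
  apply: le_lt_trans (rnormD _ _) _.
  have hz0 : 0 < rnorm z + 1 by have := rnorm_ge0 z; lra.
  move: hs; rewrite ltr_pdivlMr ?mulr_gt0 // => hs.
  have := fB t s; have := normr_ge0 (t - s); nra.
Qed.

End Cayley.

(** * Commutators *)

Definition commutator (S : pzRingType) (x y : S) := x * y - y * x.

Section Comm.
Variable S : pzRingType.
Implicit Types x y z : S.

Lemma commutatorMr x y z :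
  commutator x (y * z) = commutator x y * z + y * commutator x z.
Proof. by rewrite /commutator mulrBl mulrBr addrA !mulrA subrK. Qed.

Lemma commutatorDr x y z :
  commutator x (y + z) = commutator x y + commutator x z.
Proof. by rewrite /commutator mulrDl mulrDr opprD addrACA. Qed.

Lemma commutatorDl x y z :
  commutator (x + y) z = commutator x z + commutator y z.
Proof. by rewrite /commutator mulrDl mulrDr opprD addrACA. Qed.

Lemma commutator_commutator_sqr x y : commutator x (commutator x (y * y)) =
  commutator x (commutator x y) * y + commutator x y * commutator x y
  + (commutator x y * commutator x y + y * commutator x (commutator x y)).
Proof. by rewrite commutatorMr commutatorDr !commutatorMr. Qed.

Lemma mul_commutator x y : x * y = y * x - commutator y x.
Proof. by rewrite /commutator opprB [RHS]addrC subrK. Qed.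

Lemma sandwichB x y z : y - x * y * z = (1 - x) * y * z + y * (1 - z).
Proof. by rewrite mulrBr mulr1 !mulrBl mul1r [RHS]addrC addrA subrK. Qed.
End Comm.

Section Lie.
Local Open Scope complex_scope.
Variables (R : realType) (A : unitalCStarAlgType R).
Implicit Types (x y z r b a c : A) (t : R).

Lemma commutatorZr (k : R[i]) x y : commutator x (k *: y) = k *: commutator x y.
Proof. by rewrite /commutator scaleMl scaleMr -scalerBr. Qed.

Lemma commutatorZl (k : R[i]) x y : commutator (k *: x) y = k *: commutator x y.
Proof. by rewrite /commutator scaleMl scaleMr -scalerBr. Qed.

Lemma skew_commutator x y : skew_adjoint x -> skew_adjoint y ->
  skew_adjoint (commutator x y).
Proof.
rewrite /skew_adjoint /commutator starB !starMr => -> ->.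
by rewrite !mulrNN opprB.
Qed.

(** The analogue of real and imaginary parts; both parts stay in any C*-subalgebra
    that contains [a]. *)
Lemma skew_decomposition a : exists p q,
  [/\ skew_adjoint p, skew_adjoint q, a = p + 'i *: q &
      forall B : set A, is_cstar_subalgebra B -> B a -> B p /\ B q].
Proof.
pose p := 2^-1%:C *: (a - star a); pose q := (- 'i * 2^-1%:C) *: (a + star a).
have conji : Num.conj ('i : R[i]) = - 'i.
  rewrite -[Num.conj _]/(('i : R[i])^*%C) /=.
  by apply/eqP; rewrite eq_complex /= oppr0 !eqxx.
exists p, q; split.
- by rewrite /skew_adjoint /p starZr starB starK -scalerN opprB.
- rewrite /skew_adjoint /q starZ starD starK rmorphM rmorphN /= conji opprK.
  rewrite -scaleNr -[Num.conj 2^-1%:C]/((2^-1 : R)%:C^*%C) conjc_real.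
  by rewrite mulNr opprK addrC.
- rewrite /p /q scalerA mulrA mulrN -expr2 sqr_i opprK mul1r -scalerDr.
  by rewrite addrACA addNr addr0 scalerDr add_halves.
- move=> B hB Ba; have Bs := csub_star hB Ba; split; apply: (csubZ hB).
  + by apply: (csubD hB) => //; rewrite -scaleN1r; exact: (csubZ hB).
  + exact: (csubD hB).
Qed.

(** Conjugation by a Cayley transform moves [b] by an exact multiple of a
    commutator squeezed between two resolvents. Dividing by the parameter [t] in
    [t z] gives the derivative of conjugation without differentiating anything. *)
Lemma cayley_conjB z r b : skew_adjoint z -> inverse_of (1 + z) r ->
  let c := r * commutator b z * star r in
  (r + r - 1) * b * star (r + r - 1) - b = c + c.
Proof.
move=> hz hr c; have [uu' u'u] := cayley_unitary hz hr.
have hr' := star_inverse hz hr.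
have su : star (r + r - 1) = (1 + z) * star r.
  rewrite starB starD star1.
  by have [_] := @cayleyE _ _ (- z) _ hr'; rewrite opprK => ->.
have rsu : r * star (r + r - 1) = star r.
  by rewrite su mulrA (proj1 hr) mul1r.
set u := r + r - 1 in uu' u'u su rsu *.
have -> : u * b * star u - b = (u * b - b * u) * star u.
  by rewrite [RHS]mulrBl -(mulrA b) u'u mulr1.
have hrc : r * b - b * r = r * commutator b z * r.
  have -> : commutator b z = b * (1 + z) - (1 + z) * b.
    by rewrite mulrDl mulrDr mul1r mulr1 opprD addrACA subrr add0r.
  by rewrite mulrBr mulrBl -!mulrA (proj2 hr) mulr1 !mulrA (proj1 hr) mul1r.
have -> : u * b - b * u = (r * commutator b z + r * commutator b z) * r.
  rewrite [RHS]mulrDl -hrc /u mulrBl mulrBr mulrDl mulrDr mul1r mulr1.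
  by rewrite opprB addrA subrK opprD addrACA.
by rewrite -mulrA rsu mulrDl.
Qed.

(** * Invariant subalgebras contain the ideal generated by their commutators *)

Section Subalgebra.
Variables (B : set A) (hB : is_cstar_subalgebra B).

Lemma csubN x : B x -> B (- x).
Proof. by move=> Bx; rewrite -scaleN1r; exact: (csubZ hB). Qed.

Lemma csubB x y : B x -> B y -> B (x - y).
Proof. by move=> Bx By; apply: (csubD hB) => //; exact: csubN. Qed.

Lemma csub_half x : B (x + x) -> B x.
Proof.
by move=> Bx; rewrite -(add_halves x) -scalerDr; exact: (csubZ hB).
Qed.

Hypothesis hconj : forall u : A, unitary_component1 u -> conj_by u B `<=` B.

(** [B] is a Lie ideal: by [cayley_conjB] it contains
    [r * commutator b z * star r] with [r = (1 + t z)^-1] for every [t > 0], and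
    [r] tends to [1] as [t] tends to [0]. *)
Lemma commutator_mem_skew z b : skew_adjoint z -> B b -> B (commutator b z).
Proof.
move=> hz Bb; apply: closed_approx (csub_closed hB) _ => e e0.
set c := commutator b z.
(* Then [t * (2 * rnorm z * rnorm c) < e]; the summand [1] covers the case
   that the product of norms vanishes. *)
pose t := e / (2 * (rnorm z * rnorm c + 1)).
have nc : 0 <= rnorm z * rnorm c by rewrite mulr_ge0 // rnorm_ge0.
have t0 : 0 < t by rewrite divr_gt0 //; lra.
have te : 2 * (t * (rnorm z * rnorm c)) < e.
  have : t * (2 * (rnorm z * rnorm c + 1)) = e.
    by rewrite divfK //; apply/eqP; lra.
  nra.
have htz : skew_adjoint (t%:C *: z) by exact: skewZ.
have [r [hr r1]] := skew_inverse htz.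
have hr' := star_inverse htz hr.
have htz' : skew_adjoint (- (t%:C *: z)) by rewrite /skew_adjoint starN htz.
have r'1 : rnorm (star r) <= 1 by exact: skew_inverse_norm htz' hr'.
have rB : rnorm (1 - r) <= t * rnorm z.
  have -> : 1 - r = t%:C *: (z * r).
    by rewrite -(proj2 hr) mulrDl mul1r addrAC subrr add0r scaleMl.
  rewrite rnormZ gtr0_norm // ler_wpM2l ?(ltW t0) //.
  apply: le_trans (rnormM _ _) _; have := rnorm_ge0 z; nra.
have rB' : rnorm (1 - star r) <= t * rnorm z.
  have -> : 1 - star r = - (t%:C *: (z * star r)).
    by rewrite -(proj2 hr') mulrBl mul1r addrAC subrr add0r scaleMl.
  rewrite rnormN rnormZ gtr0_norm // ler_wpM2l ?(ltW t0) //.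
  apply: le_trans (rnormM _ _) _; have := rnorm_ge0 z; nra.
exists (r * c * star r).
  have Bd : B ((r + r - 1) * b * star (r + r - 1) - b).
    apply: csubB => //; apply: (hconj (unitary_component1_cayley htz hr)).
    by exists b.
  move: Bd; rewrite (cayley_conjB b htz hr) => /csub_half.
  rewrite commutatorZr scaleMr scaleMl -/c => /(csubZ hB (t%:C)^-1).
  rewrite scalerA mulVf ?scale1r //.
  by rewrite (_ : 0 = (0 : R)%:C) // (inj_eq (@complexI R)) gt_eqF.
rewrite sandwichB.
apply: le_lt_trans (rnormD _ _) _.
have h1 := rnormM ((1 - r) * c) (star r).
have h2 := rnormM (1 - r) c.
have h3 := rnormM c (1 - star r).
have h4 := rnorm_ge0 ((1 - r) * c).
have h5 : rnorm (1 - r) * rnorm c <= t * rnorm z * rnorm c.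
  by rewrite ler_wpM2r ?rnorm_ge0.
have h6 : rnorm c * rnorm (1 - star r) <= rnorm c * (t * rnorm z).
  by rewrite ler_wpM2l ?rnorm_ge0.
nra.
Qed.

Lemma commutator_mem a b : B b -> B (commutator b a).
Proof.
move=> Bb; have [p [q [hp hq -> _]]] := skew_decomposition a.
rewrite commutatorDr commutatorZr; apply: (csubD hB).
  exact: commutator_mem_skew.
by apply: (csubZ hB); exact: commutator_mem_skew.
Qed.

(** The largest two-sided ideal contained in [B]; it is closed because [B] is. *)
Definition ideal_core : set A := [set z | forall a c, B (a * z * c)].

Lemma coreB x y : ideal_core x -> ideal_core y -> ideal_core (x - y).
Proof. by move=> Ix Iy a c; rewrite mulrBr mulrBl; apply: csubB. Qed.

Lemma coreD x y : ideal_core x -> ideal_core y -> ideal_core (x + y).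
Proof. by move=> Ix Iy a c; rewrite mulrDr mulrDl; apply: (csubD hB). Qed.

Lemma coreZ (k : R[i]) x : ideal_core x -> ideal_core (k *: x).
Proof. by move=> Ix a c; rewrite scaleMr scaleMl; apply: (csubZ hB). Qed.

Lemma coreMl a x : ideal_core x -> ideal_core (a * x).
Proof. by move=> Ix a' c; rewrite mulrA. Qed.

Lemma coreMr a x : ideal_core x -> ideal_core (x * a).
Proof. by move=> Ix a' c; rewrite !mulrA -mulrA. Qed.

Lemma core_sub : ideal_core `<=` B.
Proof. by move=> x /(_ 1 1); rewrite mul1r mulr1. Qed.

Lemma core_approx x :
  (forall e : R, 0 < e -> exists2 y, ideal_core y & rnorm (x - y) < e) ->
  ideal_core x.
Proof.
move=> h a c; apply: closed_approx (csub_closed hB) _ => e e0.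
have na := rnorm_ge0 a; have nc := rnorm_ge0 c.
pose M := rnorm a * rnorm c + 1.
have M0 : 0 < M by rewrite ltr_wpDl // mulr_ge0.
have [y Iy xy] := h (e / M) (divr_gt0 e0 M0).
exists (a * y * c) => //; rewrite -mulrBl -mulrBr.
move: xy; rewrite ltr_pdivlMr // => xy.
apply: le_lt_trans (rnormM _ _) _.
have h1 := rnormM a (x - y); have h0 := rnorm_ge0 (x - y).
have h2 : rnorm (a * (x - y)) * rnorm c <= rnorm a * rnorm (x - y) * rnorm c.
  by rewrite ler_wpM2r.
rewrite /M in xy; nra.
Qed.

(** Herstein's observation: by the Leibniz rule
    [commutator x y * a = commutator x (y * a) - y * commutator x a], and both terms
    on the right lie in the Lie ideal and subalgebra [B]. A factor on the left is
    moved to the right at the cost of one more commutator. *)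
Lemma commutator_core x y : B x -> B y -> ideal_core (commutator x y).
Proof.
move=> Bx By.
have right a : B (commutator x y * a).
  have -> : commutator x y * a = commutator x (y * a) - y * commutator x a.
    by rewrite commutatorMr addrK.
  by apply: csubB; [|apply: (csubM hB) => //]; exact: commutator_mem.
move=> a c; rewrite -mulrA mul_commutator -mulrA.
by apply: csubB => //; exact: commutator_mem.
Qed.

(** With [D = commutator b], the element [D (D c)] lies in [ideal_core] for every
    [c]; apply this to [c = a * a] and expand by the Leibniz rule. Up to terms
    already in the ideal, what remains is [2 (D a)^2]. *)
Lemma commutator_sqr_core a b : B b ->
  ideal_core (commutator b a * commutator b a).
Proof.
move=> Bb; set d := commutator b a.
have core2 c : ideal_core (commutator b (commutator b c)).
  by apply: commutator_core => //; exact: commutator_mem.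
have : ideal_core (d * d + d * d).
  have -> : d * d + d * d =
      commutator b (commutator b (a * a)) - commutator b d * a
      - a * commutator b d.
    rewrite commutator_commutator_sqr -/d.
    rewrite -[X in X - _ - _]addrA [X in X - _ - _]addrC.
    by rewrite addrK addrA addrK.
  by apply: coreB; [apply: coreB; [|apply: coreMr]|apply: coreMl]; exact: core2.
by move=> hd; rewrite -(add_halves (d * d)) -scalerDr; exact: coreZ.
Qed.

(** A closed ideal containing [x^2] contains [x]: with [r = (1 + t x)^-1], the
    element [t x^2 r] of the ideal differs from [x] by [x r = (1 - r) / t], which is
    small for large [t]. *)
Lemma core_sqrt x : skew_adjoint x -> ideal_core (x * x) -> ideal_core x.
Proof.
move=> hx Ix; apply: core_approx => e e0.
(* Any numerator above [2] works, as [rnorm (1 - r) <= 2]. *)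
pose t := 3 / e; have t0 : 0 < t by rewrite divr_gt0.
have te : t * e = 3 by rewrite divfK ?gt_eqF.
have [r [hr r1]] := skew_inverse (skewZ t hx).
exists (t%:C *: (x * x * r)); first by apply: coreZ; exact: coreMr.
have txr : t%:C *: (x * r) = 1 - r.
  by rewrite -(proj2 hr) mulrDl mul1r scaleMl addrAC subrr add0r.
have -> : x - t%:C *: (x * x * r) = x * r.
  by rewrite -mulrA -scaleMr txr mulrBr mulr1 opprB addrC subrK.
have : rnorm (t%:C *: (x * r)) <= 2.
  by rewrite txr; have := rnormB 1 r; have := rnorm1 A; lra.
rewrite rnormZ gtr0_norm //; nra.
Qed.

(** For skew-adjoint arguments the commutator is skew-adjoint with its square in the
    ideal; the general case follows by bilinearity. *)
Lemma commutator_ideal_core a b : B b -> ideal_core (commutator b a).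
Proof.
move=> Bb.
have skew_core p q : skew_adjoint p -> skew_adjoint q -> B p ->
    ideal_core (commutator p q).
  move=> hp hq Bp; apply: core_sqrt; first exact: skew_commutator.
  exact: commutator_sqr_core.
have [p [q [hp hq bE /(_ _ hB Bb) [Bp Bq]]]] := skew_decomposition b.
have [p' [q' [hp' hq' -> _]]] := skew_decomposition a.
rewrite bE commutatorDl commutatorZl !commutatorDr !commutatorZr.
by apply: coreD; [|apply: coreZ]; (apply: coreD; [|apply: coreZ]); apply: skew_core.
Qed.

Lemma conj_by_unitary_sub u : unitary_group u -> conj_by u B `<=` B.
Proof.
move=> [_ uu] _ [b Bb <-].
have -> : u * b * star u = b - commutator b u * star u.
  rewrite /commutator [in RHS]mulrBl -(mulrA b) uu mulr1.
  by rewrite opprB [RHS]addrC subrK.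
by apply: csubB => //; apply/core_sub/coreMr/commutator_ideal_core.
Qed.
End Subalgebra.
End Lie.

Theorem corollary6p5 (R : realType) (A : unitalCStarAlgType R) (B : set A)
    (hB : is_cstar_subalgebra B)
    (hconj : forall u : A, unitary_component1 u -> conj_by u B `<=` B) :
  forall u : A, unitary_group u -> conj_by u B `<=` B.
Proof. exact: conj_by_unitary_sub hB hconj. Qed.
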